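(* Let $n\geqslant 1$ be an integer and $p\in(0,1)$, and let $X_{n,p}$ be a random variable having the binomial distribution with parameters $(n,p)$. For $x\in(0,1)$ put $$H(x,p)=x\ln\frac{x}{p}+(1-x)\ln\frac{1-x}{1-p},$$ and define $C_{n,p}(k)$, $k=0,1,\ldots,n$, by $C_{n,p}(0)=(1-p)^n$, $C_{n,p}(n)=1-p^n$, and $$C_{n,p}(k)=\Phi\left(\operatorname{sgn}\left(\frac{k}{n}-p\right)\sqrt{2nH\left(\frac{k}{n},p\right)}\right),\qquad 1\leqslant k<n.$$ Then for every $k=0,1,\ldots,n-1$, $$C_{n,p}(k)\leqslant\mathbf{P}\{X_{n,p}\leqslant k\}\leqslant C_{n,p}(k+1),$$ and equalities may happen only for $k=0$ or $k=n-1$ (that is, if equality holds in either of the two inequalities, then $k=0$ or $k=n-1$).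
   Context: The binomial distribution function is $\mathbf{P}\{X_{n,p}\leqslant k\}=\sum_{0\leqslant m\leqslant k}\binom{n}{m}p^m(1-p)^{n-m}$. The function $\Phi$ is the standard normal distribution function, $\Phi(x)=\int_{-\infty}^x \frac{1}{\sqrt{2\pi}}e^{-u^2/2}\,du$. The sign function is $\operatorname{sgn}(x)=x/|x|$ for $x\neq 0$ and $\operatorname{sgn}(0)=0$. $\ln$ denotes the natural logarithm. *)

(* Defs.v *)
From HB Require Import structures.
From mathcomp Require Import all_boot all_order all_algebra.
From mathcomp Require Import all_classical all_reals all_analysis.
Import Order.TTheory GRing.Theory Num.Theory.
Import numFieldNormedType.Exports.

Set Implicit Arguments.
Unset Strict Implicit.
Unset Printing Implicit Defensive.

Local Open Scope classical_set_scope.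
Local Open Scope ring_scope.

(* [normal_prob 0 1 A] is the Lebesgue integral over [A] of the density
   u |-> expR (- u ^+ 2 / 2) / Num.sqrt (2 * pi); its value is always finite. *)
Definition Phi (R : realType) (x : R) : R :=
  fine (normal_prob (0 : R) 1 `]-oo, x]).

(* Only meaningful for x and p in the open interval ]0, 1[. *)
Definition entropyH (R : realType) (x p : R) : R :=
  x * ln (x / p) + (1 - x) * ln ((1 - x) / (1 - p)).

(* Defined for k = 0, ..., n with 1 <= n; other arguments give junk values. *)
Definition Cnp (R : realType) (n : nat) (p : R) (k : nat) : R :=
  if k == 0%N then (1 - p) ^+ n
  else if k == n then 1 - p ^+ n
  else Phi (Num.sg (k%:R / n%:R - p)
            * Num.sqrt (2 * n%:R * entropyH (k%:R / n%:R) p)).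

(* Main.v *)
Require Import Defs.
From HB Require Import structures.
From mathcomp Require Import all_boot all_order all_algebra.
From mathcomp Require Import all_classical all_reals all_analysis.
From mathcomp Require Import ring lra zify.
Import Order.TTheory GRing.Theory Num.Theory.
Import numFieldNormedType.Exports.

Set Implicit Arguments.
Unset Strict Implicit.
Unset Printing Implicit Defensive.

Local Open Scope classical_set_scope.
Local Open Scope ring_scope.

(* Fix n and 0 < k < n, put x = k/n, and regard F(p) = P{X_{n,p} <= k} and
   C(p) = C_{n,p}(k) as functions of p.  Since exp(-n H(x,p)) is a constant
   times p^k (1-p)^(n-k), the quotient F'/C' is a constant times
   p sqrt(2nH(x,p)) / |x - p|, which is strictly increasing in p.  Hence F - C
   first increases and then decreases; its lower limits at p = 0 and p = 1 are
   nonnegative, so F > C on ]0, 1[.  The upper bound for k is the lower bound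
   for n - k - 1 under p -> 1 - p, and for k = 0 (resp. k = n - 1) the lower
   (resp. upper) bound is an equality. *)

(** * Strict monotonicity from a positive derivative *)

Section monotonicity.
Context {R : realType}.
Implicit Types (f df : R -> R) (a b x : R).

Lemma derive_gt0_lt f df a b : a < b ->
  (forall y, a <= y <= b -> {for y, continuous f}) ->
  (forall y, a < y < b -> is_derive y 1 f (df y)) ->
  (forall y, a < y < b -> 0 < df y) -> f a < f b.
Proof.
move=> ab fc fd df_gt0.
have fd' y : y \in `]a, b[ -> is_derive y 1 f (df y) by rewrite in_itv/= => /fd.
have [|c] := MVT ab fd'.
  by apply: continuous_in_subspaceT => y; rewrite inE/= in_itv/= => /fc.
rewrite in_itv/= => /df_gt0 dfc fE.
by rewrite -subr_gt0 fE mulr_gt0// subr_gt0.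
Qed.

Lemma is_derive_gt0_lt f df a b : a < b ->
  (forall y, a <= y <= b -> is_derive y 1 f (df y)) ->
  (forall y, a < y < b -> 0 < df y) -> f a < f b.
Proof.
move=> ab fd; apply: derive_gt0_lt => // y /andP[ay yb].
  have ? := fd y; apply: differentiable_continuous; apply/derivable1_diffP.
  by have [] : is_derive y 1 f (df y) by apply: fd; rewrite ay yb.
by apply: fd; rewrite !ltW.
Qed.

(** Meant for a function that need not be differentiable at [x]: [f1] and [f2] are its formulas on
    the two sides, and their continuity up to [x] lets the mean value theorem run on each side. *)
Lemma derive_gt0_lt_glue f f1 f2 df x a b : a < b ->
  (forall y, a <= y <= b -> y <= x -> f y = f1 y) ->
  (forall y, a <= y <= b -> x <= y -> f y = f2 y) ->
  (forall y, a <= y <= b -> {for y, continuous f1}) ->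
  (forall y, a <= y <= b -> {for y, continuous f2}) ->
  (forall y, a < y < b -> y < x -> is_derive y 1 f1 (df y)) ->
  (forall y, a < y < b -> x < y -> is_derive y 1 f2 (df y)) ->
  (forall y, a < y < b -> y != x -> 0 < df y) ->
  f a < f b.
Proof.
move=> ab E1 E2 c1 c2 d1 d2 df_gt0.
have left_part c : a < c <= b -> c <= x -> f a < f c.
  move=> /andP[ac cb] cx.
  rewrite E1 ?(le_trans (ltW ac) cx)// ?lexx ?(ltW ab)// (E1 c) ?cb ?(ltW ac)//.
  apply: (@derive_gt0_lt _ df) => // y /andP[ay yc].
  - by apply: c1; rewrite ay (le_trans yc).
  - by apply: d1; [rewrite ay (lt_le_trans yc)|exact: lt_le_trans cx].
  - apply: df_gt0; first by rewrite ay (lt_le_trans yc).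
    by rewrite lt_eqF// (lt_le_trans yc).
have right_part c : a <= c < b -> x <= c -> f c < f b.
  move=> /andP[ac cb] xc.
  rewrite E2 ?ac ?(ltW cb)// (E2 b) ?lexx ?(ltW ab)// ?(le_trans xc (ltW cb))//.
  apply: (@derive_gt0_lt _ df) => // y /andP[cy yb].
  - by apply: c2; rewrite yb (le_trans ac).
  - by apply: d2; [rewrite yb (le_lt_trans ac)|exact: le_lt_trans cy].
  - apply: df_gt0; first by rewrite yb (le_lt_trans ac).
    by rewrite gt_eqF// (le_lt_trans xc).
have [bx|xb] := leP b x; first by apply: left_part => //; rewrite ab lexx.
have [xa|ax] := leP x a; first by apply: right_part => //; rewrite ab lexx.
by apply: lt_trans (left_part x _ _) (right_part x _ _) => //;
  rewrite ?ax ?xb ?ltW.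
Qed.

End monotonicity.

(** * The standard normal distribution function *)

Section normal_distribution_function.
Context {R : realType}.
Implicit Types x : R.

(** As a random variable under the normal law, the identity has distribution function [Phi], so the
    general limits of a [cdf] at both infinities apply. *)
Let idTR : measurableTypeR R -> R := idfun.

#[local] HB.instance Definition _ :=
  @isMeasurableFun.Build _ _ _ _ idTR (@measurable_id _ _ setT).

Lemma Phi_le1 x : Phi x <= 1.
Proof.
rewrite /Phi -lee_fin fineK ?fin_num_measure//.
exact: (probability_le1 (@normal_prob R 0 1)).
Qed.

Lemma is_derive_Phi x : is_derive x 1 (@Phi R) (normal_pdf 0 1 x).
Proof.
(* The point [x] has to lie inside the range of integrability; [x + 1] is an arbitrary upper end. *)
have [] := @continuous_FTC1 R (normal_pdf (0 : R) 1) -oo%O x (x + 1) _ _ _ _.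
- by rewrite ltrDl.
- apply: integrableS (integrable_normal_pdf (0 : R) 1) => //=.
- by rewrite ltNyr.
- exact/continuous_normal_pdf/oner_neq0.
by move=> dPhi PhiE; apply: DeriveDef => //; rewrite -derive1E.
Qed.

Lemma continuous_Phi : continuous (@Phi R).
Proof.
move=> x; apply: differentiable_continuous; apply/derivable1_diffP.
by have [] := is_derive_Phi x.
Qed.

Lemma normal_pdf01E x :
  normal_pdf 0 1 x = normal_peak 1 * expR (- (x ^+ 2) / 2).
Proof.
by rewrite normal_pdfE ?oner_neq0// /normal_fun subr0 expr1n.
Qed.

Lemma cvg_PhiNy : @Phi R x @[x --> -oo] --> (0 : R).
Proof.
have := cvg_cdfNy0 (idTR : {RV (@normal_prob R 0 1) >-> R}).
by move/fine_cvg.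
Qed.

Lemma cvg_Phiy : @Phi R x @[x --> +oo] --> (1 : R).
Proof.
have := cvg_cdfy1 (idTR : {RV (@normal_prob R 0 1) >-> R}).
by move/fine_cvg.
Qed.

(** The density is even, so [Phi y + Phi (- y)] has zero derivative; its constant value is its limit
    1 + 0 at +oo. *)
Lemma PhiN x : Phi (- x) = 1 - Phi x.
Proof.
pose f y : R := Phi y + Phi (- y).
have f0 (y : R) : is_derive y 1 f 0.
  have dPhi := is_derive_Phi.
  have dN : is_derive y 1 (@Phi R \o -%R) (normal_pdf 0 1 (- y) * -1).
    by apply: is_derive1_comp; exact: is_deriveN.
  have : is_derive y 1 (@Phi R + (@Phi R \o -%R))
      (normal_pdf 0 1 y + normal_pdf 0 1 (- y) * -1).
    exact: is_deriveD.
  by move=> df; apply: (is_derive_eq df);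
    rewrite !normal_pdf01E sqrrN mulrN1 subrr.
have fE y : f y = f 0 by exact: is_derive_0_is_cst.
have : f y @[y --> +oo] --> (1 + 0 : R).
  apply: cvgD; first exact: cvg_Phiy.
  by have := cvg_PhiNy; rewrite cvgNy_compNP.
have -> : f = fun=> f x by apply/funext => y; rewrite !fE.
move=> /(cvg_lim (@Rhausdorff R)); rewrite lim_cst//.
by rewrite addr0 /f => <-; rewrite addrAC subrr add0r.
Qed.

End normal_distribution_function.

Lemma is_derive_mull (R : realType) (k : R) (f : R -> R) (x df : R) :
  is_derive x 1 f df -> is_derive x 1 (fun y => k * f y) (k * df).
Proof. exact: is_deriveZ. Qed.

Lemma is_derive_subl (R : realType) (k x : R) :
  is_derive x 1 (fun y => k - y) (-1).
Proof.
have d := is_deriveB (is_derive_cst k x 1) (is_derive_id x 1).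
by apply: (is_derive_eq d); rewrite sub0r.
Qed.

(** * Relative entropy of Bernoulli laws *)

Section kullback_leibler.
Context {R : realType}.
Implicit Types x p q : R.

(** The logarithms of quotients are split so that differentiation in [p] is termwise. *)
Definition kl x p : R :=
  x * (ln x - ln p) + (1 - x) * (ln (1 - x) - ln (1 - p)).

Lemma entropyHE x p : 0 < x < 1 -> 0 < p < 1 -> entropyH x p = kl x p.
Proof.
by move=> /andP[x0 x1] /andP[p0 p1];
  rewrite /entropyH !ln_div// posrE ?subr_gt0.
Qed.

Lemma klxx x : kl x x = 0.
Proof. by rewrite /kl !subrr !mulr0 addr0. Qed.

Lemma is_derive_kl x p : 0 < p < 1 ->
  is_derive p 1 (kl x) ((p - x) / (p * (1 - p))).
Proof.
move=> /andP[p0 p1].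
have q0 : 0 < 1 - p by rewrite subr_gt0.
have d1 := is_derive1_ln p0.
have d2 := is_derive_subl 1 p.
have d3 : is_derive p 1 (fun q : R => ln (1 - q)) ((1 - p)^-1 * -1).
  exact: (@is_derive1_comp _ (@ln R) (fun q => 1 - q) _ _ _
    (is_derive1_ln q0) d2).
have d4 : is_derive p 1 (fun q => x * (ln x - ln q)) (x * (0 - p^-1)).
  exact: is_derive_mull (is_deriveB (is_derive_cst _ _ _) d1).
have d5 : is_derive p 1 (fun q => (1 - x) * (ln (1 - x) - ln (1 - q)))
    ((1 - x) * (0 - (1 - p)^-1 * -1)).
  exact: is_derive_mull (is_deriveB (is_derive_cst _ _ _) d3).
apply: is_derive_eq (is_deriveD d4 d5) _.
by field; rewrite !gt_eqF.
Qed.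
End kullback_leibler.

(** * Quadratic bounds on the relative entropy, and monotonicity of the slope *)

Section kullback_leibler_bounds.
Context {R : realType}.
Implicit Types x p q : R.

Lemma continuous_kl x p : 0 < p < 1 -> {for p, continuous (kl x)}.
Proof.
move=> /(is_derive_kl x) [dkl _].
exact/differentiable_continuous/derivable1_diffP.
Qed.

(* The derivative in p of [kl x p - (x - p)^2 / (2 x (1 - p))] is
   [- (p - x)^2 (2 - p) / (2 x p (1 - p)^2)]. *)
Let kl_sub_lt x p q : 0 < x < 1 -> 0 < p -> p < q -> q < 1 ->
  (x <= p) || (q <= x) ->
  kl x q - (x - q) ^+ 2 / (2 * x * (1 - q)) <
  kl x p - (x - p) ^+ 2 / (2 * x * (1 - p)).
Proof.
move=> /andP[x0 x1] p0 pq q1 xpq.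
pose g y := (x - y) ^+ 2 / (2 * x * (1 - y)) - kl x y.
rewrite -ltrN2 !opprB.
apply: (@is_derive_gt0_lt _ g
  (fun y => (y - x) ^+ 2 * (2 - y) / (2 * x * y * (1 - y) ^+ 2))) => //.
- move=> y /andP[py yq].
  have y0 : 0 < y by exact: lt_le_trans py.
  have y1 : 0 < 1 - y by rewrite subr_gt0 (le_lt_trans yq).
  have d1 := is_derive_subl x y.
  have d2 := is_derive_mull (2 * x) (is_derive_subl 1 y).
  have d20 : 2 * x * (1 - y) != 0 by rewrite gt_eqF// !mulr_gt0.
  have d3 := @is_deriveV _ (fun y : R => 2 * x * (1 - y)) y _ 1 d20 d2.
  have d4 := is_deriveM (is_deriveX 2 d1) d3.
  have dkl : is_derive y 1 (kl x) ((y - x) / (y * (1 - y))).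
    by apply: is_derive_kl; rewrite y0 -subr_gt0.
  apply: is_derive_eq (is_deriveB d4 dkl) _.
  rewrite /GRing.scale/= !fctE.
  by field; rewrite !gt_eqF.
move=> y /andP[py yq].
have y0 : 0 < y by exact: lt_trans py.
have y1 : 0 < 1 - y by rewrite subr_gt0 (lt_trans yq).
apply: divr_gt0; last by rewrite !mulr_gt0 ?exprn_gt0.
apply: mulr_gt0; last by lra.
rewrite exprn_even_gt0//= subr_eq0; case/orP : xpq => h.
- by rewrite gt_eqF// (le_lt_trans h).
- by rewrite lt_eqF// (lt_le_trans yq).
Qed.

(** The difference of the two sides is monotone in [p] and vanishes at [p = x]. This bound and the
    next give the sign of the derivative of [kl_slope]. *)
Lemma kl_gt_lt x p : 0 < p -> p < x -> x < 1 ->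
  (x - p) ^+ 2 / (2 * x * (1 - p)) < kl x p.
Proof.
move=> p0 px x1; rewrite -subr_gt0.
have := @kl_sub_lt x p x; rewrite klxx subrr expr0n mul0r subrr.
by apply => //; rewrite ?lexx ?orbT// x1 (lt_trans p0).
Qed.

Lemma kl_lt_gt x p : 0 < x -> x < p -> p < 1 ->
  kl x p < (x - p) ^+ 2 / (2 * x * (1 - p)).
Proof.
move=> x0 xp p1; rewrite -subr_lt0.
have := @kl_sub_lt x x p; rewrite klxx subrr expr0n mul0r subrr.
by apply => //; rewrite ?lexx ?orbT// x0 (lt_trans xp).
Qed.

(* The derivative in p of [kl x p - x (x - p)^2 / (2 (1 - x) p^2)] is
   [(p - x)^2 (p + x - x p) / ((1 - x) p^3 (1 - p))]. *)
Let kl_sub_gt x p q : 0 < x < 1 -> 0 < p -> p < q -> q < 1 ->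
  (x <= p) || (q <= x) ->
  kl x p - x * (x - p) ^+ 2 / (2 * (1 - x) * p ^+ 2) <
  kl x q - x * (x - q) ^+ 2 / (2 * (1 - x) * q ^+ 2).
Proof.
move=> /andP[x0 x1] p0 pq q1 xpq.
have xx0 : 0 < 1 - x by rewrite subr_gt0.
pose g y := kl x y - x * (x - y) ^+ 2 / (2 * (1 - x) * y ^+ 2).
apply: (@is_derive_gt0_lt _ g
  (fun y => (y - x) ^+ 2 * (y + x * (1 - y)) /
    ((1 - x) * y ^+ 3 * (1 - y)))) => //.
- move=> y /andP[py yq].
  have y0 : 0 < y by exact: lt_le_trans py.
  have y1 : 0 < 1 - y by rewrite subr_gt0 (le_lt_trans yq).
  have d1 := is_derive_subl x y.
  have d2 := is_derive_mull (2 * (1 - x)) (is_deriveX 2 (is_derive_id y 1)).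
  have d20 : 2 * (1 - x) * y ^+ 2 != 0.
    by rewrite gt_eqF// !mulr_gt0// exprn_gt0.
  have d3 := @is_deriveV _ (fun y : R => 2 * (1 - x) * y ^+ 2) y _ 1 d20 d2.
  have d4 := is_deriveM (is_derive_mull x (is_deriveX 2 d1)) d3.
  have dkl : is_derive y 1 (kl x) ((y - x) / (y * (1 - y))).
    by apply: is_derive_kl; rewrite y0 -subr_gt0.
  apply: is_derive_eq (is_deriveB dkl d4) _.
  rewrite /GRing.scale/= !fctE.
  by field; rewrite !gt_eqF.
move=> y /andP[py yq].
have y0 : 0 < y by exact: lt_trans py.
have y1 : 0 < 1 - y by rewrite subr_gt0 (lt_trans yq).
apply: divr_gt0; last by rewrite !mulr_gt0 ?exprn_gt0.
apply: mulr_gt0; last by rewrite addr_gt0 ?mulr_gt0.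
rewrite exprn_even_gt0//= subr_eq0; case/orP : xpq => h.
- by rewrite gt_eqF// (le_lt_trans h).
- by rewrite lt_eqF// (lt_le_trans yq).
Qed.

(** Again a monotone difference vanishing at [p = x]. Multiplied by 2 p^2 / (x - p)^2, this bound
    and the next compare [kl_slope x p] with its value x / (1 - x) at [p = x]. *)
Lemma kl_lt_lt x p : 0 < p -> p < x -> x < 1 ->
  kl x p < x * (x - p) ^+ 2 / (2 * (1 - x) * p ^+ 2).
Proof.
move=> p0 px x1; rewrite -subr_lt0.
have := @kl_sub_gt x p x; rewrite klxx subrr expr0n mulr0 mul0r subrr.
by apply => //; rewrite ?lexx ?orbT// x1 (lt_trans p0).
Qed.

Lemma kl_gt_gt x p : 0 < x -> x < p -> p < 1 ->
  x * (x - p) ^+ 2 / (2 * (1 - x) * p ^+ 2) < kl x p.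
Proof.
move=> x0 xp p1; rewrite -subr_gt0.
have := @kl_sub_gt x x p; rewrite klxx subrr expr0n mulr0 mul0r subrr.
by apply => //; rewrite ?lexx ?orbT// x0 (lt_trans xp).
Qed.

Lemma kl_gt0 x p : 0 < x < 1 -> 0 < p < 1 -> p != x -> 0 < kl x p.
Proof.
move=> /andP[x0 x1] /andP[p0 p1]; rewrite neq_lt => /orP[px|xp].
  apply: le_lt_trans (kl_gt_lt p0 px x1).
  by rewrite divr_ge0 ?sqr_ge0// !mulr_ge0// ?subr_ge0 ltW.
apply: le_lt_trans (kl_gt_gt x0 xp p1).
have xx0 : 0 < 1 - x by rewrite subr_gt0.
apply: divr_ge0; apply: mulr_ge0; rewrite ?sqr_ge0 ?(ltW x0)//.
by rewrite ltW ?mulr_gt0.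
Qed.

Lemma kl_ge0 x p : 0 < x < 1 -> 0 < p < 1 -> 0 <= kl x p.
Proof.
move=> x01 p01; have [->|px] := eqVneq p x; first by rewrite klxx.
exact/ltW/kl_gt0.
Qed.

(* The square of F'/C', up to a constant factor; the value at [p = x] is the
   limit of the generic expression. *)
Definition kl_slope x p : R :=
  if p == x then x / (1 - x) else 2 * p ^+ 2 * kl x p / (x - p) ^+ 2.

Let kl_slope_neq x p : p != x ->
  kl_slope x p = 2 * p ^+ 2 * kl x p / (x - p) ^+ 2.
Proof. by rewrite /kl_slope => /negbTE ->. Qed.

Let kl_slope_lt_x x p : 0 < p -> p < x -> x < 1 -> kl_slope x p < kl_slope x x.
Proof.
move=> p0 px x1; rewrite {2}/kl_slope eqxx kl_slope_neq ?lt_eqF//.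
have xp0 : 0 < x - p by rewrite subr_gt0.
have xx0 : 0 < 1 - x by rewrite subr_gt0.
rewrite ltr_pdivrMr ?exprn_gt0//.
have := kl_lt_lt p0 px x1.
rewrite -(@ltr_pM2l _ (2 * p ^+ 2)) ?mulr_gt0 ?exprn_gt0//.
by congr (_ < _); field; rewrite !gt_eqF.
Qed.

Let kl_slope_gt_x x p : 0 < x -> x < p -> p < 1 -> kl_slope x x < kl_slope x p.
Proof.
move=> x0 xp p1; rewrite {1}/kl_slope eqxx kl_slope_neq ?gt_eqF//.
have xp0 : x - p < 0 by rewrite subr_lt0.
have xx0 : 0 < 1 - x by rewrite subr_gt0 (lt_trans xp).
have p0 := lt_trans x0 xp.
rewrite ltr_pdivlMr ?exprn_even_gt0//= ?lt_eqF//.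
have := kl_gt_gt x0 xp p1.
rewrite -(@ltr_pM2l _ (2 * p ^+ 2)) ?mulr_gt0 ?exprn_gt0//.
by congr (_ < _); field; rewrite !gt_eqF.
Qed.

(* The derivative in p is
   [4 x p (kl x p - (x - p)^2 / (2 x (1 - p))) / (x - p)^3]. *)
Let kl_slope_lt_side x p q : 0 < x < 1 -> 0 < p -> p < q -> q < 1 ->
  (x < p) || (q < x) -> kl_slope x p < kl_slope x q.
Proof.
move=> /andP[x0 x1] p0 pq q1 xpq.
pose g y := 2 * y ^+ 2 * kl x y / (x - y) ^+ 2.
have xNpq y : p <= y <= q -> x - y != 0.
  move=> /andP[py yq]; rewrite subr_eq0; case/orP : xpq => h.
  - by rewrite lt_eqF// (lt_le_trans h).
  - by rewrite gt_eqF// (le_lt_trans yq).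
rewrite !kl_slope_neq; last 2 first.
- by rewrite eq_sym -subr_eq0 xNpq// lexx ltW.
- by rewrite eq_sym -subr_eq0 xNpq// lexx ltW.
apply: (@is_derive_gt0_lt _ g (fun y => 4 * x * y *
  ((kl x y - (x - y) ^+ 2 / (2 * x * (1 - y))) / (x - y) ^+ 3))) => //.
- move=> y pyq; have xy := xNpq _ pyq; case/andP : pyq => py yq.
  have y0 : 0 < y by exact: lt_le_trans py.
  have y1 : 0 < 1 - y by rewrite subr_gt0 (le_lt_trans yq).
  have d1 := is_derive_subl x y.
  have d2 := is_derive_mull 2 (is_deriveX 2 (is_derive_id y 1)).
  have dkl : is_derive y 1 (kl x) ((y - x) / (y * (1 - y))).
    by apply: is_derive_kl; rewrite y0 -subr_gt0.
  have d20 : (x - y) ^+ 2 != 0 by rewrite expf_neq0.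
  have d3 := @is_deriveV _ (fun y : R => (x - y) ^+ 2) y _ 1 d20
    (is_deriveX 2 d1).
  apply: is_derive_eq (is_deriveM (is_deriveM d2 dkl) d3) _.
  rewrite /GRing.scale/= !fctE.
  by field; rewrite xy !gt_eqF.
move=> y /andP[py yq].
have y0 : 0 < y by exact: lt_trans py.
have y1 : y < 1 by exact: lt_trans q1.
apply: mulr_gt0; first by rewrite !mulr_gt0.
case/orP : xpq => h.
  have xy : x < y by exact: lt_trans py.
  by rewrite nmulr_lgt0 ?subr_lt0 ?kl_lt_gt// invr_lt0 exprn_odd_lt0// subr_lt0.
have yx : y < x by exact: lt_trans h.
by rewrite divr_gt0 ?exprn_gt0 ?subr_gt0 ?kl_gt_lt.
Qed.

(** Within one side of [x] the derivative decides; the value at [x] separates the two sides. *)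
Lemma kl_slope_lt x p q : 0 < x < 1 -> 0 < p -> p < q -> q < 1 ->
  kl_slope x p < kl_slope x q.
Proof.
move=> x01 p0 pq q1; have /andP[x0 x1] := x01.
have [qx|xq|qx] := ltgtP q x; last by subst q; exact: kl_slope_lt_x.
  by apply: kl_slope_lt_side => //; rewrite qx orbT.
have [px|xp|px] := ltgtP p x; last by subst p; exact: kl_slope_gt_x.
  exact: lt_trans (kl_slope_lt_x p0 px x1) (kl_slope_gt_x x0 xq q1).
by apply: kl_slope_lt_side => //; rewrite xp.
Qed.

End kullback_leibler_bounds.

Lemma is_derive_exprn (R : realType) n (f : R -> R) (x df : R) :
  is_derive x 1 f df ->
  is_derive x 1 (fun y => f y ^+ n) (n%:R * f x ^+ n.-1 * df).
Proof.
move=> d; have := is_deriveX n d.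
by rewrite (_ : f ^+ n = fun y => f y ^+ n)// exprfctE.
Qed.

(** * The binomial distribution function and its derivative in p *)

Section binomial_cdf.
Context {R : realType}.
Implicit Types p : R.

Definition binomial_cdf n p k : R := \sum_(m < k.+1) binomial_pmf n p m.

Lemma binomial_pmfE n p m :
  binomial_pmf n p m = 'C(n, m)%:R * (p ^+ m * (1 - p) ^+ (n - m)).
Proof. by rewrite /binomial_pmf mulr_natl. Qed.

Lemma binomial_cdf_ge0 n p k : 0 <= p <= 1 -> 0 <= binomial_cdf n p k.
Proof. by move=> p01; apply: sumr_ge0 => m _; exact: binomial_pmf_ge0. Qed.

Lemma binomial_cdf0r n k : binomial_cdf n 0 k = 1.
Proof.
rewrite /binomial_cdf big_ord_recl big1 => [|m _]; last first.
  by rewrite binomial_pmfE expr0n mul0r mulr0.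
by rewrite binomial_pmfE /= bin0 subr0 expr1n expr0 !mulr1 addr0.
Qed.

Lemma sum_binomial_pmf n p : \sum_(m < n.+1) binomial_pmf n p m = 1.
Proof.
under eq_bigr do rewrite /binomial_pmf mulrC.
by rewrite -exprDn subrK expr1n.
Qed.

Lemma binomial_pmf_onem n p m : (m <= n)%N ->
  binomial_pmf n (1 - p) (n - m) = binomial_pmf n p m.
Proof.
by move=> mn; rewrite !binomial_pmfE bin_sub// subKn// subKr (mulrC (p ^+ _)).
Qed.

(** Reversing the index, m -> n - m, turns the left side into the upper tail m > k of the law with
    parameter [p]. *)
Lemma binomial_cdf_onem n p k : (k < n)%N ->
  binomial_cdf n (1 - p) (n - k.+1) = 1 - binomial_cdf n p k.
Proof.
move=> kn; apply/eqP; rewrite -subr_eq0 opprB addrA subr_eq0 addrC; apply/eqP.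
rewrite -[RHS](sum_binomial_pmf n p) /binomial_cdf.
rewrite -!(big_mkord xpredT (binomial_pmf n _)).
rewrite [RHS](big_cat_nat (n := k.+1))//=; last exact: ltnW.
congr (_ + _); rewrite [RHS] big_nat_rev/= -[in RHS](add0n k.+1)
  big_addn -subSn//.
apply: eq_big_nat => m /andP[_ mn].
rewrite -[RHS]binomial_pmf_onem; last by lia.
by congr binomial_pmf; lia.
Qed.

(** By (m+1) C(n, m+1) = (n-m) C(n, m) the derivative is a difference of consecutive terms, so that
    the sum over m telescopes. *)
Lemma is_derive_binomial_pmf n m p : (0 < m < n)%N ->
  is_derive p 1 (fun p => binomial_pmf n p m)
    ((m * 'C(n, m))%:R * (p ^+ m.-1 * (1 - p) ^+ (n - m))
    - (m.+1 * 'C(n, m.+1))%:R * (p ^+ m * (1 - p) ^+ (n - m.+1))).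
Proof.
move=> /andP[m0 mn].
rewrite (_ : (fun p => _) =
    fun p => 'C(n, m)%:R * (p ^+ m * (1 - p) ^+ (n - m))); last first.
  by apply/funext => q; rewrite binomial_pmfE.
have d1 := is_derive_exprn m (is_derive_id p 1).
have d2 := is_derive_exprn (n - m) (is_derive_subl 1 p).
apply: is_derive_eq (is_derive_mull _ (is_deriveM d1 d2)) _.
rewrite /GRing.scale/= mul_bin_left !natrM subnS.
by ring.
Qed.

Lemma is_derive_binomial_cdf n k p : (k < n)%N ->
  is_derive p 1 (fun p => binomial_cdf n p k)
    (- ((k.+1 * 'C(n, k.+1))%:R * (p ^+ k * (1 - p) ^+ (n - k.+1)))).
Proof.
elim: k => [|k IH] kn.
  rewrite (_ : (fun p => _) = fun q : R => (1 - q) ^+ n); last first.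
    apply/funext => q; rewrite /binomial_cdf big_ord1 binomial_pmfE bin0 mul1r.
    by rewrite subn0 mul1r.
  apply: is_derive_eq (is_derive_exprn n (is_derive_subl 1 p)) _.
  by rewrite /GRing.scale/= bin1 subn1 mulrN1 mul1r mul1n.
rewrite (_ : (fun p => _) =
    (fun p => binomial_cdf n p k) + (fun p => binomial_pmf n p k.+1));
  last first.
  by apply/funext => q; rewrite /binomial_cdf big_ord_recr.
apply: is_derive_eq
  (is_deriveD (IH (ltnW kn)) (is_derive_binomial_pmf _ _)) _ => //.
by rewrite addrA addNr add0r.
Qed.

Lemma probability_binomial_le d (T : measurableType d) (P : probability T R)
    (X : {RV P >-> nat}) n p k : 0 <= p <= 1 -> (k < n)%N ->
  distribution P X = binomial_prob n p ->
  P [set w | (X w <= k)%N] = (binomial_cdf n p k)%:E.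
Proof.
move=> p01 kn PX.
have -> : P [set w | (X w <= k)%N] = distribution P X `I_k.+1.
  by rewrite /distribution/= /pushforward; congr (P _).
rewrite PX /binomial_prob p01 esum_fset//=; last first.
  by move=> m _; rewrite lee_fin binomial_pmf_ge0.
by rewrite -fsbig_ord//= sumEFin.
Qed.

End binomial_cdf.

(** * The strict lower bound for 0 < k < n *)

Section interior.
Context {R : realType} (n k : nat).
Hypotheses (k_gt0 : (0 < k)%N) (k_lt_n : (k < n)%N).
Implicit Types p q : R.

Let N : R := n%:R.
Let x : R := k%:R / N.
Let M : R := (k.+1 * 'C(n, k.+1))%:R.
Let s p : R := Num.sqrt (2 * N * kl x p).
(** The factor free of p in the normal density at [s p], which equals c p^k (1-p)^(n-k). *)
Let c : R := normal_peak 1 * expR (- (N * (x * ln x + (1 - x) * ln (1 - x)))).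

Let N_gt0 : 0 < N. Proof. by rewrite ltr0n (leq_ltn_trans _ k_lt_n). Qed.

Let M_gt0 : 0 < M.
Proof. by rewrite ltr0n muln_gt0/= bin_gt0. Qed.

Let c_gt0 : 0 < c.
Proof. by rewrite mulr_gt0 ?expR_gt0// normal_peak_gt0// oner_neq0. Qed.

Let x01 : 0 < x < 1.
Proof.
by apply/andP; split;
  [rewrite divr_gt0// ltr0n|rewrite ltr_pdivrMr// mul1r ltr_nat].
Qed.

Let s_gt0 p : 0 < p < 1 -> p != x -> 0 < s p.
Proof. by move=> p01 px; rewrite sqrtr_gt0 !mulr_gt0// kl_gt0. Qed.

Let sqr_s p : 0 < p < 1 -> s p ^+ 2 = 2 * N * kl x p.
Proof.
by move=> p01; rewrite sqr_sqrtr// mulr_ge0 ?kl_ge0// mulr_ge0// ltW.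
Qed.

Let continuous_s p : 0 < p < 1 -> {for p, continuous s}.
Proof.
move=> p01; apply: continuous_comp; last exact: sqrt_continuous.
by apply: cvgM; [exact: cvg_cst|exact: continuous_kl].
Qed.

Let is_derive_s p : 0 < p < 1 -> p != x ->
  is_derive p 1 s (N * (p - x) / (p * (1 - p) * s p)).
Proof.
move=> p01 px; have s0 := s_gt0 p01 px; have /andP[p0 p1] := p01.
have d1 := is_derive_mull (2 * N) (is_derive_kl x p01).
have kl0 : 0 < 2 * N * kl x p by rewrite -sqrtr_gt0.
have d2 := @is_derive1_comp _ Num.sqrt (fun q => 2 * N * kl x q) _ _ _
  (is_derive1_sqrt kl0) d1.
apply: is_derive_eq d2 _; rewrite -/(s p).
by field; rewrite !gt_eqF ?subr_gt0.
Qed.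

Let expR_kl p : 0 < p < 1 ->
  normal_peak 1 * expR (- (N * kl x p)) = c * (p ^+ k * (1 - p) ^+ (n - k)).
Proof.
move=> /andP[p0 p1]; rewrite /c -mulrA; congr (_ * _).
have Nx : N * x = k%:R by rewrite mulrC divfK ?gt_eqF.
have -> : p ^+ k = expR (N * x * ln p) by rewrite Nx expRM_natl lnK.
have -> : (1 - p) ^+ (n - k) = expR (N * (1 - x) * ln (1 - p)).
  by rewrite mulrBr mulr1 Nx -natrB 1?ltnW// expRM_natl lnK// posrE subr_gt0.
by rewrite -!expRD /kl; congr expR; ring.
Qed.

Let D p : R := binomial_cdf n p k - Phi (Num.sg (x - p) * s p).

Let dD p : R := - (M * (p ^+ k * (1 - p) ^+ (n - k.+1)))
  + c * (p ^+ k * (1 - p) ^+ (n - k)) * (N * `|p - x| / (p * (1 - p) * s p)).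

(* Here e = 1 for p < x and e = -1 for p > x; the two formulas agree at p = x,
   where s vanishes and need not be differentiable. *)
Let is_derive_D (e p : R) : 0 < p < 1 -> p != x -> e ^+ 2 = 1 ->
  `|p - x| = - e * (p - x) ->
  is_derive p 1 (fun q => binomial_cdf n q k - Phi (e * s q)) (dD p).
Proof.
move=> p01 px e1 epx.
have d1 := is_derive_binomial_cdf p k_lt_n.
have d2 := @is_derive1_comp _ (@Phi R) (fun q => e * s q) _ _ _
  (is_derive_Phi _) (is_derive_mull e (is_derive_s p01 px)).
apply: is_derive_eq (is_deriveB d1 d2) _; congr (_ + _).
rewrite normal_pdf01E exprMn e1 mul1r sqr_s//.
rewrite (_ : - (2 * N * kl x p) / 2 = - (N * kl x p)); last by field.
by rewrite expR_kl// epx; ring.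
Qed.

(** With a = c N |p - x| and b = M p s(p), this is (a^2 - b^2) / |p - x|^2 for p != x; squaring
    removes the root in [s] and brings in the monotone [kl_slope]. *)
Let T p : R := (c * N) ^+ 2 - M ^+ 2 * N * kl_slope x p.

Let T_lt p q : 0 < p -> p < q -> q < 1 -> T q < T p.
Proof.
move=> p0 pq q1; rewrite /T ltrD2l ltrN2 ltr_pM2l ?kl_slope_lt//.
by rewrite mulr_gt0// exprn_gt0.
Qed.

Let dD_T p : 0 < p < 1 -> p != x -> exists2 w, 0 < w & dD p = w * T p.
Proof.
move=> p01 px; have s0 := s_gt0 p01 px; have /andP[p0 p1] := p01.
have q0 : 0 < 1 - p by rewrite subr_gt0.
have a0 : 0 < `|p - x| by rewrite normr_gt0 subr_eq0.
have ab0 : 0 < c * N * `|p - x| + M * (p * s p).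
  by apply: addr_gt0; do !apply: mulr_gt0 => //.
(* [dD p] is a positive multiple of a - b = (a^2 - b^2) / (a + b), where a = c N |p - x| and b = M p
   s(p); the witness collects the positive factors. *)
exists (p ^+ k * (1 - p) ^+ (n - k.+1) / (p * s p) *
  (`|p - x| ^+ 2 / (c * N * `|p - x| + M * (p * s p)))).
  by rewrite mulr_gt0// divr_gt0 ?mulr_gt0 ?exprn_gt0.
have -> : T p =
    ((c * N * `|p - x|) ^+ 2 - (M * (p * s p)) ^+ 2) / `|p - x| ^+ 2.
  rewrite (exprMn _ (c * N)) (exprMn _ M) (exprMn _ p) sqr_s//.
  rewrite /T /kl_slope (negbTE px) real_normK ?num_real//.
  by field; rewrite !subr_eq0 px eq_sym px.
(* One factor 1 - p is split off (1-p)^(n-k) to cancel the one in the denominator. *)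
rewrite /dD -(subnSK k_lt_n) exprS.
rewrite subr_sqr; move: (M) (N) ab0 => m N' ab0.
by field; rewrite !gt_eqF.
Qed.

Let sg1E p : p <= x -> Num.sg (x - p) * s p = 1 * s p.
Proof.
rewrite le_eqVlt => /orP[/eqP->|px]; last by rewrite gtr0_sg ?subr_gt0.
by rewrite /s klxx mulr0 sqrtr0 !mulr0.
Qed.

Let sgN1E p : x <= p -> Num.sg (x - p) * s p = -1 * s p.
Proof.
rewrite le_eqVlt => /orP[/eqP<-|px]; last by rewrite ltr0_sg ?subr_lt0.
by rewrite /s klxx mulr0 sqrtr0 !mulr0.
Qed.

Let continuous_piece (e p : R) : 0 < p < 1 ->
  {for p, continuous (fun q => binomial_cdf n q k - Phi (e * s q))}.
Proof.
move=> p01; apply: cvgB.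
  apply/differentiable_continuous/derivable1_diffP.
  by have [] := is_derive_binomial_cdf p k_lt_n.
apply: (@continuous_comp _ _ _ (fun q => e * s q) (@Phi R));
  last exact: continuous_Phi.
by apply: cvgM; [exact: cvg_cst|exact: continuous_s].
Qed.

(** Used with [u = 1] where [D] increases and with [u = -1] where it decreases. *)
Let D_monotone (u a b : R) : 0 < a -> a < b -> b < 1 ->
  (forall y, a < y < b -> 0 < u * T y) -> u * D a < u * D b.
Proof.
move=> a0 ab b1 T0.
pose f e q := u * (binomial_cdf n q k - Phi (e * s q)).
have ab01 y : a <= y <= b -> 0 < y < 1.
  by move=> /andP[ay yb]; rewrite (lt_le_trans a0)// (le_lt_trans yb).
have ab01' y : a < y < b -> 0 < y < 1.
  by move=> /andP[ay yb]; rewrite ab01// !ltW.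
have f_cont e y : a <= y <= b -> {for y, continuous (f e)}.
  by move=> /ab01 y01; apply: cvgM; [exact: cvg_cst|exact: continuous_piece].
apply: (@derive_gt0_lt_glue _ (fun q => u * D q) (f 1) (f (-1))
   (fun q => u * dD q) x) => //; try exact: f_cont.
- by move=> y _ yx; rewrite /D sg1E.
- by move=> y _ xy; rewrite /D sgN1E.
- move=> y /ab01' y01 yx; apply: is_derive_mull; apply: is_derive_D => //.
  + by rewrite lt_eqF.
  + by rewrite expr1n.
  + by rewrite ltr0_norm ?subr_lt0// mulN1r.
- move=> y /ab01' y01 xy; apply: is_derive_mull; apply: is_derive_D => //.
  + by rewrite gt_eqF.
  + by rewrite sqrrN expr1n.
  + by rewrite gtr0_norm ?subr_gt0// opprK mul1r.
- move=> y aby yx; have [w w0 ->] := dD_T (ab01' _ aby) yx.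
  by rewrite mulrCA mulr_gt0// T0.
Qed.

(** The binomial term tends to 1 as p tends to 0, and [Phi] never exceeds 1. *)
Let D_near0 e : 0 < e -> \forall p \near 0^'+, - e < D p.
Proof.
move=> e0.
have Fc : binomial_cdf n p k @[p --> 0^'+] --> (1 : R).
  rewrite -(binomial_cdf0r n k); apply: cvg_at_right_filter.
  apply/differentiable_continuous/derivable1_diffP.
  by have [] := is_derive_binomial_cdf (0 : R) k_lt_n.
have : \forall p \near 0^'+, 1 - e < binomial_cdf n p k.
  by apply: (cvgr_gt 1 Fc); rewrite ltrBlDr ltrDl.
apply: filterS => p Fp; rewrite /D ltrBrDr (le_lt_trans _ Fp)//.
by rewrite addrC lerD2r Phi_le1.
Qed.

(** The term -(1-x) ln(1-p) blows up, while -x ln p stays nonnegative. *)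
Let kl_cvg1 : kl x p @[p --> 1^'-] --> +oo.
Proof.
have /andP[x0 x1] := x01.
apply/cvgryPge => B.
pose B' := expR (- ((B - x * ln x - (1 - x) * ln (1 - x)) / (1 - x))).
near=> p.
have p0 : 0 < p by near: p; exact: nbhs_left_gt.
have p1 : p < 1 by near: p; exact: nbhs_left_lt.
have lnp : x * ln p <= 0 by rewrite pmulr_rle0// ln_le0// ltW.
have : ln (1 - p) <= - ((B - x * ln x - (1 - x) * ln (1 - x)) / (1 - x)).
  rewrite -[leRHS]expRK ler_ln ?posrE ?expR_gt0 ?subr_gt0//.
  rewrite lerBlDr -lerBlDl; near: p; apply: nbhs_left_ge.
  by rewrite gtrBl expR_gt0.
rewrite lerNr ler_pdivrMr ?subr_gt0// /kl; lra.
Unshelve. all: by end_near. Qed.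

(** Here s(p) tends to +oo, so Phi(-s(p)) tends to 0, and the binomial term is nonnegative. *)
Let D_near1 e : 0 < e -> \forall p \near 1^'-, - e < D p.
Proof.
move=> e0; have /andP[x0 x1] := x01.
have : \forall y \near -oo, Phi y < e by exact: (cvgr_lt 0 cvg_PhiNy).
move=> [B [_ PhiB]].
near=> p.
have p0 : 0 < p by near: p; exact: nbhs_left_gt.
have p1 : p < 1 by near: p; exact: nbhs_left_lt.
have xp : x < p by near: p; exact: nbhs_left_gt.
have F0 : 0 <= binomial_cdf n p k by rewrite binomial_cdf_ge0// !ltW.
suff : Phi (Num.sg (x - p) * s p) < e by rewrite /D; lra.
rewrite sgN1E ?ltW// mulN1r; apply: PhiB.
(* [B] may have either sign, so |B| < s(p) is shown instead, by comparing squares. *)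
rewrite ltrNl (le_lt_trans (ler_norm _))// -sqrtr_sqr /s ltr_sqrt.
  rewrite sqrrN -ltr_pdivrMl ?mulr_gt0//.
  by near: p; move/cvgryPgt : kl_cvg1; exact.
by rewrite mulr_gt0 ?mulr_gt0 ?kl_gt0// ?p0// gt_eqF.
Unshelve. all: by end_near. Qed.

Let D_gt0 q : 0 < q < 1 -> 0 < D q.
Proof.
move=> /andP[q0 q1].
(* [T] is strictly decreasing: if [T q >= 0], then [D] increases on ]0, q]; otherwise it decreases
   on [q, 1[. Either way [q] is compared with the end where [D] is monotone. *)
have [Tq|Tq] := leP 0 (T q).
  have D_incr a b : 0 < a -> a < b -> b <= q -> D a < D b.
    move=> a0 ab bq; rewrite -(mul1r (D a)) -(mul1r (D b)).
    apply: D_monotone => //; first exact: le_lt_trans q1.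
    move=> y /andP[ay yb];
      rewrite mul1r (le_lt_trans Tq)// T_lt ?(lt_trans a0)//.
    exact: lt_le_trans bq.
  (* The behaviour near 0 yields only [0 <= D (q / 2)]; the step from q / 2 to q makes it strict. *)
  apply: le_lt_trans (D_incr (q / 2) q _ _ _) => //; [|lra..].
  apply/ler_addgt0Pr => e e0; rewrite -lerBlDr sub0r ltW//.
  near (0 : R)^'+ => p.
  apply: (@lt_trans _ _ (D p)).
    by near: p; exact: D_near0.
  apply: D_incr; last lra.
  - by near: p; exact: nbhs_right_gt.
  - by near: p; apply: nbhs_right_lt; lra.
have D_decr a b : q <= a -> a < b -> b < 1 -> D b < D a.
  move=> qa ab b1; rewrite -ltrN2 -(mulN1r (D a)) -(mulN1r (D b)).
  have a0 := lt_le_trans q0 qa.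
  apply: D_monotone => // y /andP[ay yb].
  rewrite mulN1r oppr_gt0 (lt_trans _ Tq)// T_lt//.
    exact: le_lt_trans ay.
  exact: lt_trans b1.
(* The midpoint of q and 1 plays the same role on this side. *)
apply: le_lt_trans (D_decr q ((1 + q) / 2) _ _ _) => //; [|lra..].
apply/ler_addgt0Pr => e e0; rewrite -lerBlDr sub0r ltW//.
near (1 : R)^'- => p.
apply: (@lt_trans _ _ (D p)).
  by near: p; exact: D_near1.
apply: D_decr; first lra.
- by near: p; apply: nbhs_left_gt; lra.
- by near: p; exact: nbhs_left_lt.
Unshelve. all: by end_near. Qed.

Lemma Cnp_lt_binomial_cdf p : 0 < p < 1 -> Cnp n p k < binomial_cdf n p k.
Proof.
move=> p01; rewrite /Cnp gtn_eqF// ltn_eqF// entropyHE//.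
by rewrite -subr_gt0 D_gt0.
Qed.

End interior.

(** * Reflection p -> 1 - p, and assembly of both bounds *)

Lemma Cnp_onem (R : realType) n j (p : R) : (0 < j < n)%N -> 0 < p < 1 ->
  Cnp n (1 - p) (n - j) = 1 - Cnp n p j.
Proof.
move=> /andP[j0 jn] p01; have n0 : 0 < n%:R :> R by rewrite ltr0n; lia.
rewrite /Cnp.
have [-> -> -> ->] : [/\ (n - j == 0)%N = false, (n - j == n)%N = false,
    (j == 0)%N = false & (j == n)%N = false] by split; lia.
(* The reflection negates j/n - p and swaps the two terms of the entropy, so the argument of [Phi]
   just changes sign. *)
rewrite -PhiN.
have -> : (n - j)%:R / n%:R = 1 - j%:R / n%:R :> R.
  by rewrite natrB 1?ltnW// mulrBl divff ?gt_eqF.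
have -> : 1 - j%:R / n%:R - (1 - p) = - (j%:R / n%:R - p) by ring.
rewrite sgrN mulNr; congr (Phi (- (_ * Num.sqrt (_ * _)))).
by rewrite /entropyH !subKr addrC.
Qed.

Theorem mainTheorem1 (R : realType) (d : measure_display)
    (T : measurableType d) (P : probability T R) (X : {RV P >-> nat})
    (n : nat) (p : R) (n_ge1 : (1 <= n)%N) (p_gt0 : 0 < p) (p_lt1 : p < 1)
    (X_binomial : distribution P X = binomial_prob n p) (k : nat)
    (k_lt_n : (k < n)%N) :
  ((Cnp n p k)%:E <= P [set w | (X w <= k)%N])%E /\
  (P [set w | (X w <= k)%N] <= (Cnp n p k.+1)%:E)%E /\
  ((Cnp n p k)%:E = P [set w | (X w <= k)%N] \/
   P [set w | (X w <= k)%N] = (Cnp n p k.+1)%:E ->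
   k = 0%N \/ k = (n - 1)%N).
Proof.
have p01 : 0 < p < 1 by rewrite p_gt0.
have q01 : 0 < 1 - p < 1 by lra.
rewrite (probability_binomial_le _ k_lt_n X_binomial); last by rewrite !ltW.
have lower_lt : (0 < k)%N -> Cnp n p k < binomial_cdf n p k.
  by move=> k0; exact: Cnp_lt_binomial_cdf.
have upper_lt : (k.+1 < n)%N -> binomial_cdf n p k < Cnp n p k.+1.
  (* The lower bound at index n - k - 1 and parameter 1 - p is complemented on both sides; the index
     of [Cnp] then reflects to k + 1, that of the distribution function to k. *)
  move=> k1n; have := @Cnp_lt_binomial_cdf R n (n - k.+1) _ _ (1 - p) q01.
  rewrite Cnp_onem// binomial_cdf_onem// ltrD2l ltrN2; apply; lia.
have lower_eq : k = 0%N -> Cnp n p k = binomial_cdf n p k.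
  move=> ->; rewrite /Cnp eqxx /binomial_cdf big_ord1 binomial_pmfE.
  by rewrite bin0 expr0 subn0 !mul1r.
have upper_eq : k.+1 = n -> binomial_cdf n p k = Cnp n p k.+1.
  move=> k1n; rewrite /Cnp k1n eqxx gtn_eqF//.
  (* For k = n - 1 the distribution function is the total mass 1 minus the last mass p^n. *)
  have := sum_binomial_pmf n p; rewrite big_ord_recr/= (binomial_pmfE _ _ n).
  rewrite binn subnn mul1r mulr1 /binomial_cdf k1n => <-.
  by rewrite addrK.
rewrite !lee_fin; split; [|split].
- by case: (posnP k) => [/lower_eq->//|/lower_lt/ltW].
- by move: k_lt_n; rewrite leq_eqVlt => /orP[/eqP/upper_eq->//|/upper_lt/ltW].
- case: (posnP k) => [->|k0]; first by left.
  move: k_lt_n; rewrite leq_eqVlt => /orP[/eqP k1n _|k1n].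
    by right; rewrite -k1n subn1.
  case=> -[] /eqP; first by rewrite (lt_eqF (lower_lt k0)).
  by rewrite (lt_eqF (upper_lt k1n)).
Qed.
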